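(* Let $F:B^{s_D}_{p_D}\to L_2$ be linear and continuous, where $s_D\in\mathbb{R}$, $p_D>1$, and suppose that the range of its adjoint is $\operatorname{rg}F^*=B^{s_G}_{p_G}\subset (B^{s_D}_{p_D})^*=B^{-s_D}_{p_D^*}$. Let $v\in L_2$ and $Fu^\dagger=v$ with $u^\dagger\in B^{s_S}_{p_S}\subset B^{s_D}_{p_D}$, where $p_S\le p_G$. Let further $p>0$ with $p_S\le p\le\min\{p_D,p_G\}$ and let $\varepsilon>0$. For $\delta>0$ let $v^\delta\in L_2$ satisfy $\|v-v^\delta\|_{L_2}\le\delta$, and let $\alpha=\alpha(\delta)>0$ satisfy $\alpha\asymp\delta$. Let $$p_R=\frac{p+p_G}{p_G},\qquad s_R\le\frac{p\,s_S-p_Gs_G}{p+p_G}-d\Big(\frac1{p+p_G}\Big(\frac p{p_S}-1\Big)\Big)-\varepsilon\Big(\frac p{p_S}-1\Big).$$ Then for each choice of minimizers $u^{\alpha,\delta}\in B^{s_D}_{p_D}$ of the Tikhonov functional $$T_\alpha(u)=\|Fu-v^\delta\|_{L_2}^2+\alpha\|u\|_{B^{s_R}_{p_R}}^{p_R},\qquad u\in B^{s_D}_{p_D},$$ one has the convergence rate $$\|u^{\alpha,\delta}-u^\dagger\|_{H^\sigma}=\mathcal{O}(\sqrt\delta)\quad\text{as }\delta\to0,\qquad\text{where } \sigma:=s_R+d\Big(\frac12-\frac1{p_R}\Big).$$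
   Context: All function spaces consist of functions or distributions on a fixed set $\Omega\subset\mathbb{R}^d$; $L_2=L_2(\Omega)$. $B^s_p:=B^s_{p,p}$ denotes the Besov space with smoothness $s\in\mathbb{R}$ and both integrability indices equal to $p>0$; $H^s=B^s_{2}$ is the Sobolev space. A wavelet basis $\{\psi_\lambda\}_{\lambda\in\Lambda}$, orthonormal in $L_2$ (with $|\lambda|$ the scale of the index $\lambda$), is fixed which characterizes all Besov spaces under consideration, and $B^s_p$ is equipped with the (equivalent) norm (quasi-norm if $p<1$) $$\|u\|_{B^s_p}^p=\sum_{\lambda\in\Lambda}2^{p(s+d(\frac12-\frac1p))|\lambda|}|u_\lambda|^p,\qquad u_\lambda=\langle u,\psi_\lambda\rangle .$$ Inclusion $\subset$ between Besov spaces means continuous embedding; $B^{s_1}_{p_1}\subset B^{s_2}_{p_2}$ holds if $s_1-\frac d{p_1}>s_2-\frac d{p_2}$ and $p_1\le p_2$. The conjugate exponent $p^*$ is defined by $\frac1p+\frac1{p^*}=1$, and $(B^s_p)^*$ is identified with $B^{-s}_{p^*}$ through the $L_2$ duality pairing. For $u\in B^{s_D}_{p_D}\setminus B^{s_R}_{p_R}$ one sets $\|u\|_{B^{s_R}_{p_R}}=\infty$. $A\asymp B$ means there are constants $c,C>0$ (here independent of $\delta$) with $cA\le B\le CA$. *)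

(* Defs.v *)
From HB Require Import structures.
From mathcomp Require Import all_boot all_order all_algebra.
From mathcomp Require Import all_classical all_reals all_analysis.

Set Implicit Arguments.
Unset Strict Implicit.
Unset Printing Implicit Defensive.
Import Order.TTheory GRing.Theory Num.Theory.
Import numFieldNormedType.Exports.
Local Open Scope classical_set_scope.
Local Open Scope ring_scope.

Notation euclidean R dim := (dim.-tuple (measurableTypeR R)).

(* The library has Lebesgue measure on the line only.  A measure on the Borel
   sets of R^dim is the Lebesgue measure iff it gives every closed box its
   volume. *)
Definition is_lebesgue_measure (R : realType) (dim : nat)
    (mu : {measure set (euclidean R dim) -> \bar R}) : Prop :=
  forall a b : euclidean R dim,
    (forall i, (tnth a i : R) <= tnth b i) ->
    mu [set x | forall i, (tnth a i : R) <= tnth x i <= tnth b i]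
      = (\prod_(i < dim) ((tnth b i : R) - tnth a i))%:E.

(* Square integrable functions, not their classes: equality in L_2 is
   [f = g %[ae m]]. *)
Notation L2 m := (LfunType m (lee1n 2)).

Section L2.
Context (disp : measure_display) (T : measurableType disp) (R : realType)
        (m : {measure set T -> \bar R}).

Definition L2_norm (f : L2 m) : R := fine ('N[m]_2%:E[EFin \o f])%E.

Definition L2_inner (f g : L2 m) : R := \int[m]_x (f x * g x).

End L2.

Section wavelets.
Context (disp : measure_display) (T : measurableType disp) (R : realType)
        (m : {measure set T -> \bar R}).

Record wavelet_basis := WaveletBasis {
  wav_index : countType ;
  wav_scale : wav_index -> nat ;
  wav : wav_index -> L2 m ;
  wav_orthonormal : forall l k, L2_inner (wav l) (wav k) = (l == k)%:R ;
  wav_complete : forall (f : L2 m) (e : R), 0 < e ->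
    exists s : seq wav_index,
      uniq s /\ L2_norm (f - \sum_(l <- s) L2_inner f (wav l) *: wav l) < e
}.

(* An ambient vector space of distributions: the part of it that matters is
   that it contains L_2, that its elements have wavelet coefficients
   <u, psi_l> extending the L_2 inner product, and that an element is
   determined by these. *)
Record distributions (W : wavelet_basis) := Distributions {
  dist :> lmodType R ;
  of_L2 : L2 m -> dist ;
  coef : dist -> wav_index W -> R ;
  coef_linear : forall (a : R) (u v : dist) l,
    coef (a *: u + v) l = a * coef u l + coef v l ;
  coef_inj : forall u v : dist, coef u =1 coef v -> u = v ;
  coef_of_L2 : forall f l, coef (of_L2 f) l = L2_inner f (wav l)
}.

End wavelets.

Section besov.
Context (disp : measure_display) (T : measurableType disp) (R : realType)
        (m : {measure set T -> \bar R}) (W : wavelet_basis m)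
        (dim : nat).

Definition besov_seq_norm (s p : R) (c : wav_index W -> R) : \bar R :=
  ((\esum_(l in [set: wav_index W])
      (2 `^ (p * (s + dim%:R * (1 / 2 - 1 / p)) * (wav_scale l)%:R)
         * `|c l| `^ p)%:E) `^ p^-1)%E.

Context (E : distributions W).

(* +oo outside of B^s_p *)
Definition besov_norm (s p : R) (u : E) : \bar R := besov_seq_norm s p (coef u).

Definition besov (s p : R) : set E := [set u | (besov_norm s p u < +oo)%E].

Definition sobolev_norm (s : R) (u : E) : \bar R := besov_norm s 2 u.

(* Together with [coef_inj] and the definition of [besov]: the coefficient map
   is a bijection between B^s_p and the coefficient sequences of finite norm. *)
Definition characterized (s p : R) : Prop :=
  forall c : wav_index W -> R, (besov_seq_norm s p c < +oo)%E ->
    exists u : E, coef u =1 c.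

(* Continuity on the domain D for the (quasi-)norms NU and NV. *)
Definition continuous_for (U V : zmodType) (NU : U -> \bar R)
    (NV : V -> \bar R) (D : set U) (f : U -> V) : Prop :=
  forall u, D u -> forall e : R, 0 < e -> exists2 eta : R, 0 < eta &
    forall u', D u' -> (NU (u' - u)%R < eta%:E)%E -> (NV (f u' - f u)%R < e%:E)%E.

Definition besov_embedding (s1 p1 s2 p2 : R) : Prop :=
  besov s1 p1 `<=` besov s2 p2 /\
  continuous_for (besov_norm s1 p1) (besov_norm s2 p2) (besov s1 p1) id.

(* Only the values of F on B^s_p matter. *)
Definition linear_on_besov (s p : R) (F : E -> L2 m) : Prop :=
  forall (a : R) (u v : E), besov s p u -> besov s p v ->
    F (a *: u + v) = a *: F u + F v %[ae m].

Definition continuous_on_besov (s p : R) (F : E -> L2 m) : Prop :=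
  continuous_for (besov_norm s p) (fun f : L2 m => (L2_norm f)%:E)
    (besov s p) F.

(* The L_2 pairing, by Parseval sum_l g_l u_l; this series converges
   absolutely for u in B^s_p and g in B^-s_p*, and its sum is then the
   difference of the sums of the positive and the negative parts. *)
Definition duality (g u : E) : R :=
  let f l := (coef g l * coef u l)%:E in
  fine (\esum_(l in [set: wav_index W]) f^\+%E l)
  - fine (\esum_(l in [set: wav_index W]) f^\-%E l).

(* g in B^-s_q represents the functional F^* w on B^s_p, 1/p + 1/q = 1 *)
Definition adjoint_value (s p q : R) (F : E -> L2 m) (w : L2 m) (g : E) : Prop :=
  besov (- s) q g /\
  forall u, besov s p u -> L2_inner (F u) w = duality g u.

Definition adjoint_range (s p q : R) (F : E -> L2 m) : set E :=
  [set g | exists w : L2 m, adjoint_value s p q F w g].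

Definition tikhonov (F : E -> L2 m) (vd : L2 m) (alpha sR pR : R) (u : E) : \bar R :=
  ((L2_norm (F u - vd)%R ^+ 2)%:E + alpha%:E * besov_norm sR pR u `^ pR)%E.

Definition minimizer_on (D : set E) (J : E -> \bar R) (u : E) : Prop :=
  D u /\ forall u', D u' -> (J u <= J u')%E.

End besov.

(* A(delta) ~ B(delta) up to constants independent of delta > 0 *)
Definition asymp_equiv (R : realType) (A B : R -> R) : Prop :=
  exists c C : R, [/\ 0 < c, 0 < C &
    forall delta, 0 < delta -> c * B delta <= A delta <= C * B delta].

(* f(delta) = O(g(delta)) as delta -> 0, for delta > 0 *)
Definition bigO_right0 (R : realType) (f : R -> \bar R) (g : R -> R) : Prop :=
  exists C : R, \forall delta \near 0^'+, (f delta <= (C * g delta)%:E)%E.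

(* Main.v *)
(* Write q = p_R = 1 + p / p_G, so that 1 < q <= 2, x_l = 2^(sigma |l|) u_l and
   y_l = 2^(sigma |l|) udag_l.  The penalty of u is sum_l |x_l|^q, and its
   gradient at udag is q xi with xi_l = 2^(sigma |l|) sgn(y_l) |y_l|^(q-1).  As
   (q - 1) p_G = p, the condition on s_R bounds the B^{s_G}_{p_G}-norm of xi by
   the l^p-norm of the weighted coefficients of udag, which is finite since
   udag is in B^{s_S}_{p_S} and p_S <= p.  Hence xi = F^* w for some w.  With
   this source condition minimality bounds the Bregman distance of the penalty
   between u^{alpha,delta} and udag by O(delta).  Since the penalties stay
   bounded, all |x_l| and |y_l| lie in some [0, M], where |t|^q is strongly
   convex because q <= 2; so the Bregman distance dominates
   sum_l |x_l - y_l|^2, the squared H^sigma-norm of the error. *)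

Require Import Defs.
From mathcomp Require Import all_boot all_order all_algebra.
From mathcomp Require Import all_classical all_reals all_analysis.
From mathcomp Require Import measurable_realfun ring lra.

Set Implicit Arguments.
Unset Strict Implicit.
Unset Printing Implicit Defensive.
Import Order.TTheory GRing.Theory Num.Theory.
Import numFieldNormedType.Exports.
Local Open Scope classical_set_scope.
Local Open Scope ring_scope.

(** * Strong convexity of |t|^q on bounded intervals, for 1 < q <= 2 *)

Section powR_convexity.
Context {R : realType}.
Implicit Types a b q r x y M : R.

Lemma powR_MVT r a b : 0 < a -> a < b ->
  exists2 c, a < c < b & b `^ r - a `^ r = r * c `^ (r - 1) * (b - a).
Proof.
move=> a0 ab.
have [||c cab ->] := @MVT R (fun t => t `^ r) (fun c => r * c `^ (r - 1)) a b ab.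
- move=> x; rewrite in_itv/= => /andP[ax _].
  by apply: is_derive1_powR; exact: lt_trans ax.
- apply: derivable_within_continuous => x; rewrite in_itv/= => /andP[ax _].
  by apply: derivable_powR; rewrite in_itv/= andbT (lt_le_trans a0).
- by exists c => //; move: cab; rewrite in_itv.
Qed.

Lemma ler_powR_base r x y : r <= 0 -> 0 < x -> x <= y -> y `^ r <= x `^ r.
Proof.
move=> r0 x0 xy; have y0 := lt_le_trans x0 xy.
rewrite -lef_pV2 ?posrE ?powR_gt0// -!powRN.
by rewrite ge0_ler_powR ?nnegrE ?oppr_ge0// ltW.
Qed.

(** Mean value theorem: as r <= 1, the derivative r c^(r-1) is nonincreasing in c, hence at least
    its value at M. *)
Lemma powR_sub_lower r a b M : 0 <= r <= 1 -> 0 < a -> a <= b -> b <= M ->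
  r * M `^ (r - 1) * (b - a) <= b `^ r - a `^ r.
Proof.
move=> /andP[r0 r1] a0; rewrite le_eqVlt => /predU1P[<-|ab bM].
  by rewrite !subrr mulr0.
have [c /andP[ac cb] ->] := powR_MVT r a0 ab.
rewrite ler_wpM2r ?subr_ge0 ?(ltW ab)// ler_wpM2l//.
apply: ler_powR_base; first by rewrite subr_le0.
- exact: lt_trans ac.
- by rewrite (le_trans (ltW cb)).
Qed.

(* The derivative of t |-> t^q - q y^(q-1) t - K (t - y)^2 vanishes at y and,
   by the previous lemma, has the sign of t - y. *)
Lemma powR_strong_convex_gt0 q M x y : 1 < q <= 2 -> 0 < x <= M -> 0 < y <= M ->
  (q - 1) / 2 * M `^ (q - 2) * (x - y) ^+ 2 <=
  x `^ q - y `^ q - q * y `^ (q - 1) * (x - y).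
Proof.
move=> /andP[q1 q2] /andP[x0 xM] /andP[y0 yM].
set K := (q - 1) / 2 * _.
have K0 : 0 <= K by rewrite mulr_ge0 ?powR_ge0//; lra.
pose H t := t `^ q + (- (q * y `^ (q - 1))) * t + (- K) * (t - y) ^+ 2.
pose dH t := q * t `^ (q - 1) - q * y `^ (q - 1) - 2 * K * (t - y).
have dHE (t : R) : 0 < t -> is_derive t 1 H (dH t).
  move=> t0; rewrite /H.
  have h1 := is_derive1_powR q t0.
  apply: is_derive_eq; rewrite /dH /GRing.scale/=; ring.
suff : H y <= H x by rewrite /H subrr; lra.
have cts a b : 0 < a -> {within `[a, b], continuous H}.
  move=> a0; apply: derivable_within_continuous => t; rewrite in_itv/= => /andP[at_ _].
  by apply: ex_derive; apply: dHE; exact: lt_le_trans at_.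
(* 2K is the factor (q - 1) M^(q-2) that [powR_sub_lower] gives for the exponent q - 1; the extra
   factor q > 1 only enlarges a nonnegative increment. *)
have aux a b : 0 < a -> a <= b -> b <= M ->
    2 * K * (b - a) <= q * b `^ (q - 1) - q * a `^ (q - 1).
  move=> a0 ab bM.
  have ba0 : 0 <= b - a by rewrite subr_ge0.
  have q01 : 0 <= q - 1 <= 1 by apply/andP; split; lra.
  have := powR_sub_lower q01 a0 ab bM.
  rewrite (_ : q - 1 - 1 = q - 2); last by ring.
  have -> : (q - 1) * M `^ (q - 2) * (b - a) = 2 * K * (b - a).
    by rewrite /K; field.
  have P0 : 0 <= 2 * K * (b - a) by rewrite mulr_ge0// mulr_ge0.
  move=> Ple; apply: (le_trans Ple); rewrite -mulrBr.
  by rewrite ler_peMl ?(ltW q1)// (le_trans P0 Ple).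
case: (ltgtP x y) => [xy|yx|->//].
- have [|c] := @MVT R H dH x y xy _ (cts _ _ x0).
    by move=> t; rewrite in_itv/= => /andP[xt _]; apply: dHE; exact: lt_trans xt.
  rewrite in_itv/= => /andP[xc cy] E; rewrite -subr_le0 E.
  have h := aux c y (lt_trans x0 xc) (ltW cy) yM.
  rewrite mulr_le0_ge0 ?subr_ge0 ?(ltW xy)// /dH; lra.
- have [|c] := @MVT R H dH y x yx _ (cts _ _ y0).
    by move=> t; rewrite in_itv/= => /andP[yt _]; apply: dHE; exact: lt_trans yt.
  rewrite in_itv/= => /andP[yc cx] E; rewrite -subr_ge0 E.
  have h := aux y c y0 (ltW yc) (le_trans (ltW cx) xM).
  rewrite mulr_ge0 ?subr_ge0 ?(ltW yx)// /dH; lra.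
Qed.

Lemma powR_ge_quad r M x : 0 <= r <= 2 -> 0 <= x <= M -> r != 0 ->
  M `^ (r - 2) * x ^+ 2 <= x `^ r.
Proof.
move=> /andP[r0 r2] /andP[x0 xM] rn0.
move: x0; rewrite le_eqVlt => /predU1P[<-|x0].
  by rewrite expr0n/= mulr0 powR_ge0.
have -> : x `^ r = x `^ (r - 2) * x ^+ 2.
  rewrite -powR_mulrn ?(ltW x0)// -powRD ?subrK//.
  by apply/implyP => _; rewrite gt_eqF.
by rewrite ler_wpM2r ?sqr_ge0// ler_powR_base// subr_le0.
Qed.

(** Replacing (x, y) by (-x, -y) allows y >= 0. Two positive arguments are the case above; when 0
    lies between x and y, out of reach of a mean value argument on positive reals, the bound |t|^q
    >= M^(q-2) t^2 takes over. *)
Lemma powR_strong_convex q M x y : 1 < q <= 2 -> `|x| <= M -> `|y| <= M ->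
  (q - 1) / 2 * M `^ (q - 2) * (x - y) ^+ 2 <=
  `|x| `^ q - `|y| `^ q - q * (Num.sg y * `|y| `^ (q - 1)) * (x - y).
Proof.
move=> q12; have /andP[q1 q2] := q12.
wlog y0 : x y / 0 <= y.
  move=> h xM yM; case: (leP 0 y) => [y0|/ltW y0]; first exact: h.
  have := h (- x) (- y); rewrite !normrN sgrN oppr_ge0 => /(_ y0 xM yM).
  lra.
rewrite (ger0_norm y0) => xM yM.
have q0 : q != 0 by apply/eqP; lra.
have q02 : 0 <= q <= 2 by apply/andP; split; lra.
have xq : M `^ (q - 2) * `|x| ^+ 2 <= `|x| `^ q.
  by apply: powR_ge_quad => //; rewrite normr_ge0.
have yq : M `^ (q - 2) * y ^+ 2 <= y `^ q.
  by apply: powR_ge_quad => //; rewrite y0.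
move: xq yq; have := powR_ge0 M (q - 2); set N := M `^ _ => N0 xq yq.
have [y_eq0|y_neq0] := eqVneq y 0.
  move: yq; rewrite y_eq0 sgr0 powR0// !subr0 mul0r mulr0 mul0r subr0 => _.
  apply: le_trans xq; rewrite real_normK ?num_real// ler_wpM2r ?sqr_ge0//.
  by rewrite ler_piMl//; lra.
have {y_neq0 y0}y0 : 0 < y by rewrite lt_neqAle eq_sym y_neq0.
rewrite gtr0_sg// mul1r.
have yyq : y `^ q = y * y `^ (q - 1) by rewrite mulr_powRB1 ?(ltW y0)//; lra.
have [x0|x0|x0] := ltgtP 0 x.
- rewrite gtr0_norm//; apply: powR_strong_convex_gt0 => //.
    by rewrite x0 -(gtr0_norm x0).
  by rewrite y0.
- have yq1 : N * y <= y `^ (q - 1).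
    by rewrite -(ler_pM2l y0) -yyq; apply: le_trans yq; rewrite mulrCA expr2.
  move: xq; rewrite real_normK ?num_real// => xq.
  rewrite -subr_ge0.
  (* For x < 0 < y the difference of the two sides splits into nonnegative terms: multiples of the
     surpluses of |x|^q, y^q and y^(q-1) over N x^2, N y^2 and N y, and N times a quadratic form
     whose mixed term -xy is positive. *)
  have -> : `|x| `^ q - y `^ q - q * y `^ (q - 1) * (x - y) -
      (q - 1) / 2 * N * (x - y) ^+ 2 =
      (`|x| `^ q - N * x ^+ 2) + (q - 1) * (y `^ q - N * y ^+ 2)
      + q * (- x) * (y `^ (q - 1) - N * y)
      + N * ((1 - (q - 1) / 2) * x ^+ 2 + (q - 1) / 2 * y ^+ 2 + (- x) * y).
    by rewrite yyq; field.
  have yx0 : 0 <= - x * y by rewrite mulr_ge0// ?oppr_ge0 ltW.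
  have x20 : 0 <= (1 - (q - 1) / 2) * x ^+ 2.
    by apply: mulr_ge0 (sqr_ge0 x); lra.
  have y20 : 0 <= (q - 1) / 2 * y ^+ 2 by apply: mulr_ge0 (sqr_ge0 y); lra.
  have h1 : 0 <= (q - 1) * (y `^ q - N * y ^+ 2) by apply: mulr_ge0; lra.
  have h2 : 0 <= q * - x * (y `^ (q - 1) - N * y).
    by apply: mulr_ge0; [apply: mulr_ge0|]; lra.
  by rewrite addr_ge0 ?mulr_ge0//; lra.
- move: xq; rewrite -x0 normr0 powR0// => _.
  have -> : 0 - y `^ q - q * y `^ (q - 1) * (0 - y) = (q - 1) * y `^ q.
    by rewrite yyq; ring.
  have : 0 <= (q - 1) * (y `^ q - N * y ^+ 2) by rewrite mulr_ge0; lra.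
  have : 0 <= (q - 1) * (N * y ^+ 2).
    by apply: mulr_ge0 (mulr_ge0 N0 (sqr_ge0 y)); lra.
  lra.
Qed.

End powR_convexity.

(** * Sums of real families over an arbitrary index type *)

Section esum_lemmas.
Context {R : realType} {I : choiceType}.
Implicit Types (a b e f g : I -> R) (k : R).

Lemma esumZl (a : I -> \bar R) k : 0 < k -> (forall i, 0 <= a i)%E ->
  (\esum_(i in [set: I]) (k%:E * a i) = k%:E * \esum_(i in [set: I]) a i)%E.
Proof.
move=> k0 a0; rewrite /esum -ereal_sup_pZl//; congr ereal_sup.
by rewrite image_comp; apply: eq_imagel => A _ /=; rewrite ge0_mule_fsumr.
Qed.

Definition asum f : \bar R := \esum_(i in [set: I]) (f i)%:E.

Lemma ge0_asumD f g : (forall i, 0 <= f i) -> (forall i, 0 <= g i) ->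
  (asum (fun i => f i + g i)%R = asum f + asum g)%E.
Proof. by move=> f0 g0; rewrite -esumD// => i _; rewrite lee_fin. Qed.

Lemma ge0_asumZ f k : 0 < k -> (forall i, 0 <= f i) ->
  (asum (fun i => k * f i)%R = k%:E * asum f)%E.
Proof. by move=> k0 f0; rewrite -esumZl// => i; rewrite lee_fin. Qed.

Lemma le_asum f g : (forall i, f i <= g i) -> (asum f <= asum g)%E.
Proof. by move=> fg; apply: le_esum => i _; rewrite lee_fin. Qed.

Lemma asum_ge0 f : (forall i, 0 <= f i) -> (0 <= asum f)%E.
Proof. by move=> f0; apply: esum_ge0 => i _; rewrite lee_fin. Qed.

Lemma le_asum_term f i : (forall j, 0 <= f j) -> ((f i)%:E <= asum f)%E.
Proof.
move=> f0; apply: esum_ge; exists [set i] => //.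
by rewrite fsbig_set1.
Qed.

(* [duality g u] is the value for f l = g_l u_l. *)
Definition dsum f : R :=
  fine (asum (fun i => Num.max (f i) 0)) -
  fine (asum (fun i => Num.max (- f i) 0)).

(** Sums the termwise inequality although f and g may change sign: their negative parts are moved
    across, so that both sides are sums of nonnegative families. Finiteness of the sum of a is part
    of the conclusion. *)
Lemma asum_sub_le a b e f g k : 0 < k ->
  (forall i, 0 <= a i) -> (forall i, 0 <= b i) -> (forall i, 0 <= e i) ->
  (asum b < +oo)%E -> (asum e < +oo)%E ->
  (asum (fun i => `|f i|)%R < +oo)%E -> (asum (fun i => `|g i|)%R < +oo)%E ->
  (forall i, a i + b i + k * (f i - g i) <= e i) ->
  (asum a <= (fine (asum e) - fine (asum b) - k * (dsum f - dsum g))%:E)%E.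
Proof.
move=> k0 a0 b0 e0 boo eoo foo goo abe.
pose p f i : R := Num.max (f i) 0; pose n f i : R := Num.max (- f i) 0.
have p0 f' i : 0 <= p f' i by rewrite le_max lexx orbT.
have n0 f' i : 0 <= n f' i by rewrite le_max lexx orbT.
have pP (f' : I -> R) i : p f' i - n f' i = f' i.
  rewrite /p /n; case: (leP (f' i) 0) => h; case: (leP (- f' i) 0) => h'; lra.
have posoo f' : (asum (fun i => `|f' i|)%R < +oo)%E -> (asum (p f') < +oo)%E.
  by apply: le_lt_trans; apply: le_asum => i; rewrite ge_max ler_norm normr_ge0.
have negoo f' : (asum (fun i => `|f' i|)%R < +oo)%E -> (asum (n f') < +oo)%E.
  by apply: le_lt_trans; apply: le_asum => i; rewrite ge_max -normrN ler_norm normr_ge0.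
have fin f' : (forall i, 0 <= f' i) -> (asum f' < +oo)%E -> asum f' = (fine (asum f'))%:E.
  by move=> f0 oo; rewrite fineK// ge0_fin_numE// asum_ge0.
have le : (asum (fun i => (a i + b i + (k * p f i + k * n g i))%R) <=
    asum (fun i => (e i + (k * n f i + k * p g i))%R))%E.
  apply: le_asum => i; have := abe i.
  by rewrite -{1}(pP f i) -{1}(pP g i); lra.
have kp0 f' i : 0 <= k * p f' i by rewrite mulr_ge0// ltW.
have kn0 f' i : 0 <= k * n f' i by rewrite mulr_ge0// ltW.
rewrite !ge0_asumD// in le; try by move=> i; rewrite addr_ge0.
rewrite !ge0_asumZ// in le.
move: le; rewrite /dsum -/(p f) -/(p g) -/(n f) -/(n g).
rewrite (fin _ b0 boo) (fin _ e0 eoo).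
rewrite (fin _ (p0 f) (posoo f foo)) (fin _ (p0 g) (posoo g goo)).
rewrite (fin _ (n0 f) (negoo f foo)) (fin _ (n0 g) (negoo g goo)) /=.
have : (0 <= asum a)%E by exact: asum_ge0.
case: (asum a) => [r| |]//= _.
by rewrite -!EFinM -!EFinD !lee_fin; lra.
Qed.

(** The inclusion of l^r in l^p: each |f i|^r is at most the whole sum K, so |f i|^p <= K^(p/r-1) |f
    i|^r. *)
Lemma asum_powR_nested f r p : 0 < r -> r <= p ->
  (asum (fun i => `|f i| `^ r)%R < +oo)%E ->
  (asum (fun i => `|f i| `^ p)%R < +oo)%E.
Proof.
move=> r0 rp oo; set K := fine (asum (fun i => `|f i| `^ r)%R).
have K0 : 0 <= K by rewrite fine_ge0// asum_ge0// => i; rewrite powR_ge0.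
have KE : asum (fun i => `|f i| `^ r)%R = K%:E.
  by rewrite fineK// ge0_fin_numE// asum_ge0// => i; rewrite powR_ge0.
(* The summand 1 keeps the factor positive when K = 0, as [ge0_asumZ] requires. *)
pose k := K `^ (p / r - 1) + 1.
have k0 : 0 < k by rewrite ltr_wpDl ?powR_ge0.
apply: (@le_lt_trans _ _ (asum (fun i => k * `|f i| `^ r)%R)).
  apply: le_asum => i; rewrite mulrC.
  have -> : `|f i| `^ p = (`|f i| `^ r) * (`|f i| `^ r) `^ (p / r - 1).
    rewrite mulr_powRB1 ?powR_ge0 ?divr_gt0 ?(lt_le_trans r0)//.
    by rewrite -powRrM mulrC divfK// gt_eqF.
  rewrite ler_wpM2l ?powR_ge0// (@le_trans _ _ (K `^ (p / r - 1)))//; last first.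
    by rewrite lerDl.
  rewrite ge0_ler_powR ?nnegrE ?powR_ge0//.
    by rewrite subr_ge0 ler_pdivlMr// mul1r.
  by rewrite -lee_fin -KE le_asum_term// => j; rewrite powR_ge0.
rewrite ge0_asumZ//.
by rewrite KE -EFinM ltry.
Qed.

(** Young's inequality, summed term by term; only finiteness is wanted, not the sharp Hölder
    bound. *)
Lemma asum_young f g p q : 0 < p -> 0 < q -> p^-1 + q^-1 = 1 ->
  (asum (fun i => `|f i| `^ p)%R < +oo)%E ->
  (asum (fun i => `|g i| `^ q)%R < +oo)%E ->
  (asum (fun i => `|f i * g i|)%R < +oo)%E.
Proof.
move=> p0 q0 pq foo goo.
apply: (@le_lt_trans _ _ (asum (fun i => p^-1 * `|f i| `^ p + q^-1 * `|g i| `^ q)%R)).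
  apply: le_asum => i; rewrite normrM ![_^-1 * _]mulrC.
  exact: conjugate_powR.
rewrite ge0_asumD; try by move=> i; rewrite mulr_ge0 ?powR_ge0// invr_ge0 ltW.
rewrite !ge0_asumZ ?invr_gt0//; try by move=> i; rewrite powR_ge0.
by rewrite lte_add_pinfty// lte_mul_pinfty// ?lee_fin ?invr_ge0 ltW.
Qed.

End esum_lemmas.

(** * Norm and inner product of L_2 *)

Section L2_lemmas.
Context (disp : measure_display) (T : measurableType disp) (R : realType)
        (m : {measure set T -> \bar R}).
Implicit Types f g h : L2 m.

Lemma L2_norm_ge0 f : 0 <= L2_norm f.
Proof. by rewrite fine_ge0// Lnorm_ge0. Qed.

Lemma L2_measurable f : measurable_fun [set: T] f.
Proof. exact: measurable_funPT. Qed.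

(** [F udag] and v agree only almost everywhere; this lemma and [eq_L2_inner] let one replace the
    other. *)
Lemma eq_L2_norm f g : f = g %[ae m] -> L2_norm f = L2_norm g.
Proof.
move=> fg; rewrite /L2_norm; congr fine; rewrite !Lnorm.unlock; congr (_ `^ _)%E.
apply: ae_eq_integral => //.
1, 2: apply: (measurableT_comp (measurable_poweR _)).
1, 2: apply: measurableT_comp => //; apply/measurable_EFinP; exact: L2_measurable.
by apply: filterS fg => x /= /[apply] ->.
Qed.

Lemma L2_mul_integrable f g : m.-integrable [set: T] (EFin \o (f \* g)).
Proof. by apply/Lfun1_integrable; apply: Lfun2_mul_Lfun1; exact: LfunP. Qed.

Lemma eq_L2_inner f g h : f = g %[ae m] -> L2_inner f h = L2_inner g h.
Proof.
move=> fg; rewrite /L2_inner /Rintegral; congr fine.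
apply: ae_eq_integral => //.
1, 2: apply/measurable_EFinP; apply: measurable_funM; exact: L2_measurable.
by apply: filterS fg => x /= /[apply] ->.
Qed.

Lemma L2_innerBl f g h : L2_inner (f - g) h = L2_inner f h - L2_inner g h.
Proof.
rewrite /L2_inner -RintegralB//; [|exact: L2_mul_integrable..].
by apply: eq_Rintegral => x _; rewrite -mulrBl.
Qed.

Lemma L2_cauchy_schwarz f g : `|L2_inner f g| <= L2_norm f * L2_norm g.
Proof.
apply: le_trans (le_normr_Rintegral measurableT (L2_mul_integrable f g)) _.
rewrite -lee_fin EFinM !finite_norm_fine.
have half : 2^-1 + 2^-1 = 1 :> R by lra.
have := hoelder m (L2_measurable f) (L2_measurable g) (ltr0Sn _ _) (ltr0Sn _ _) half.
rewrite Lnorm1; apply: le_trans.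
rewrite /Rintegral fineK//.
apply: integrable_fin_num => //.
exact: integrable_norm (L2_mul_integrable f g).
Qed.

End L2_lemmas.

(** * The gradient of the penalty, Bregman distances, and estimates for the Tikhonov functional *)

Section powR_grad.
Context {R : realType}.
Implicit Types q y : R.

(** The derivative of |t|^q at y, divided by q. *)
Definition powR_grad q y : R := Num.sg y * `|y| `^ (q - 1).

Lemma norm_powR_grad q y : 1 < q -> `|powR_grad q y| = `|y| `^ (q - 1).
Proof.
move=> q1; rewrite /powR_grad normrM normr_sg (ger0_norm (powR_ge0 _ _)).
have [->|y0] := eqVneq y 0; last by rewrite mul1r.
by rewrite mul0r normr0 powR0// subr_eq0 gt_eqF.
Qed.

Lemma powR_grad_mul q y : 1 < q -> powR_grad q y * y = `|y| `^ q.
Proof.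
move=> q1; rewrite /powR_grad mulrAC -normrEsg mulr_powRB1//.
exact: lt_trans q1.
Qed.

End powR_grad.

(** The right-hand side is the Bregman distance of the q-th power sum. It is bounded below by
    summing [powR_strong_convex] over the indices. *)
Lemma bregman_bound (R : realType) (I : choiceType) (q M rx ry : R) (x y : I -> R) :
  1 < q <= 2 -> 1 <= M -> rx <= M -> ry <= M ->
  asum (fun i => `|x i| `^ q) = rx%:E -> asum (fun i => `|y i| `^ q) = ry%:E ->
  (asum (fun i => `|powR_grad q (y i) * x i|)%R < +oo)%E ->
  ((((q - 1) / 2 * M `^ (q - 2))%:E * asum (fun i => `|x i - y i| `^ 2)%R
   <= (rx - ry - q * (dsum (fun i => powR_grad q (y i) * x i)%R -
                      dsum (fun i => powR_grad q (y i) * y i)%R))%:E))%E.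
Proof.
move=> q12 M1 rxM ryM rxE ryE hx_oo; have /andP[q1 q2] := q12.
have K0 : 0 < (q - 1) / 2 * M `^ (q - 2).
  by rewrite !mulr_gt0 ?subr_gt0 ?invr_gt0 ?powR_gt0// (lt_le_trans _ M1).
(* A term with |z i| > 1 satisfies |z i| <= |z i|^q <= r; the other terms are covered by 1 <= M. *)
have bnd (z : I -> R) (r : R) : asum (fun i => `|z i| `^ q) = r%:E -> r <= M ->
    forall i, `|z i| <= M.
  move=> zr rM i; case: (leP `|z i| 1) => [z1|z1]; first exact: le_trans M1.
  apply: (le_trans (le1r_powR (ltW z1) (ltW q1))); apply: le_trans rM.
  rewrite -lee_fin -zr.
  by apply: (@le_asum_term _ _ (fun i => `|z i| `^ q)) => j; rewrite powR_ge0.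
rewrite -ge0_asumZ//.
rewrite -[X in (_ <= (X - _ - _)%:E)%E]/(fine rx%:E) -[X in (_ <= (_ - X - _)%:E)%E]/(fine ry%:E).
rewrite -rxE -ryE; apply: asum_sub_le.
- lra.
- by move=> i; rewrite mulr_ge0 ?powR_ge0// ltW.
- by move=> i; rewrite powR_ge0.
- by move=> i; rewrite powR_ge0.
- by rewrite ryE ltry.
- by rewrite rxE ltry.
- by [].
- apply: le_lt_trans (ltry ry); rewrite -ryE; apply: le_asum => i.
  by rewrite powR_grad_mul// (ger0_norm (powR_ge0 _ _)).
- move=> i; have := powR_strong_convex q12 (bnd x rx rxE rxM i) (bnd y ry ryE ryM i).
  rewrite -/(powR_grad q (y i)) powR_mulrn ?normr_ge0// real_normK ?num_real//.
  lra.
Qed.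

(* t is the residual |F u - v_delta|, z the pairing <F u - v, w> and B the
   Bregman distance. *)
Lemma tikhonov_real_bound (R : realType) (q c C a d t w z rx ry B : R) :
  0 < c -> 0 < a -> 0 < d -> 0 <= w -> 0 <= t -> 0 < q ->
  c * d <= a -> a <= C * d ->
  t ^+ 2 + a * rx <= d ^+ 2 + a * ry ->
  `|z| <= (t + d) * w -> B = rx - ry - q * z ->
  B <= (c^-1 + C * q ^+ 2 * w ^+ 2 / 4 + q * w) * d.
Proof.
move=> c0 a0 d0 w0 t0 q0 ca aC min zle ->.
have da : d ^+ 2 <= a * (c^-1 * d).
  by rewrite mulrCA mulrC -ler_pdivrMr ?invr_gt0// invrK expr2; nra.
have zq : - (q * z) <= q * ((t + d) * w).
  by rewrite -mulrN ler_pM2l// (le_trans _ zle)// -normrN ler_norm.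
(* Completing the square: t^2 from the minimality absorbs a q t w at the cost of a^2 q^2 w^2 / 4. *)
have key : a * (rx - ry - q * z) <= a * (c^-1 * d + a * q ^+ 2 * w ^+ 2 / 4 + q * w * d).
  have := sqr_ge0 (t - a * q * w / 2).
  have : a * - (q * z) <= a * (q * ((t + d) * w)) by rewrite ler_pM2l.
  lra.
rewrite ler_pM2l// in key; apply: (le_trans key).
have : a * (q ^+ 2 * w ^+ 2) <= C * d * (q ^+ 2 * w ^+ 2).
  by rewrite ler_wpM2r// mulr_ge0 ?sqr_ge0.
lra.
Qed.
(** Keeps the penalties bounded as d tends to 0: division by a leaves d^2 / a <= d / c <= 1 / c. *)
Lemma le_mulr_bound (R : realFieldType) (c a d t rx ry : R) :
  0 < c -> 0 < d -> d <= 1 -> c * d <= a -> t ^+ 2 + a * rx <= d ^+ 2 + a * ry ->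
  rx <= c^-1 + ry.
Proof.
move=> c0 d0 d1 ca min; have a0 : 0 < a by rewrite (lt_le_trans _ ca)// mulr_gt0.
have da : d ^+ 2 <= a * c^-1.
  rewrite ler_pdivlMr// (le_trans _ ca)// mulrC ler_wpM2l ?(ltW c0)//.
  by rewrite expr2 ler_piMl// ltW.
rewrite -(ler_pM2l a0) mulrDr; have := sqr_ge0 t; lra.
Qed.

(** * Besov norms as weighted sequence norms, and the rate under a source condition *)

Section besov_lemmas.
Context (disp : measure_display) (T : measurableType disp) (R : realType)
        (m : {measure set T -> \bar R}) (W : wavelet_basis m) (dim : nat).
Implicit Types (c : wav_index W -> R) (s p t : R).

Definition scaled t c l : R := 2 `^ (t * (wav_scale l)%:R) * c l.

(** The weight that makes the B^s_p norm of c the l^p norm of [scaled (besov_exponent s p) c]. At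
    s_R and p_R it is the sigma of the theorem. *)
Definition besov_exponent s p : R := s + dim%:R * (1 / 2 - 1 / p).

Definition besov_mass s p c : \bar R :=
  asum (fun l => `|scaled (besov_exponent s p) c l| `^ p).

Lemma norm_scaled t c l : `|scaled t c l| = 2 `^ (t * (wav_scale l)%:R) * `|c l|.
Proof. by rewrite normrM ger0_norm ?powR_ge0. Qed.

Lemma powR_scaled t c l p :
  `|scaled t c l| `^ p = 2 `^ (p * t * (wav_scale l)%:R) * `|c l| `^ p.
Proof.
rewrite norm_scaled powRM ?powR_ge0// -powRrM.
by congr (_ `^ _ * _); ring.
Qed.

Lemma besov_seq_normE s p c :
  besov_seq_norm dim s p c = (besov_mass s p c `^ p^-1)%E.
Proof.
congr (_ `^ _)%E; apply: eq_esum => l _.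
by rewrite powR_scaled.
Qed.

Lemma besov_mass_ge0 s p c : (0 <= besov_mass s p c)%E.
Proof. by apply: asum_ge0 => l; rewrite powR_ge0. Qed.

Lemma besov_seq_norm_poweR s p c : 0 < p ->
  (besov_seq_norm dim s p c `^ p)%E = besov_mass s p c.
Proof.
move=> p0; rewrite besov_seq_normE -poweRrM mulVf ?gt_eqF// poweRe1//.
exact: besov_mass_ge0.
Qed.

Lemma besov_seq_norm_lty s p c : 0 < p ->
  (besov_seq_norm dim s p c < +oo)%E <-> (besov_mass s p c < +oo)%E.
Proof.
move=> p0; rewrite besov_seq_normE; split.
  by apply: lty_poweRy; rewrite invr_eq0 gt_eqF.
exact: poweR_lty.
Qed.

Context (E : distributions W).

Lemma besovP s p (u : E) : 0 < p ->
  besov dim s p u <-> (besov_mass s p (coef u) < +oo)%E.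
Proof. exact: besov_seq_norm_lty. Qed.

Lemma coefB (u v : E) l : coef (u - v) l = coef u l - coef v l.
Proof. by rewrite addrC -scaleN1r coef_linear mulN1r addrC. Qed.

Lemma dualityE (g u : E) : duality g u = dsum (fun l => coef g l * coef u l).
Proof.
rewrite /duality /dsum; congr (fine _ - fine _); apply: eq_esum => l _.
  by rewrite funeposE EFin_max.
by rewrite funenegE -EFinN EFin_max.
Qed.

(** For conjugate exponents the weights of B^s_p and B^(-s)_p' cancel, so [asum_young] applies to
    the scaled coefficients. *)
Lemma duality_summable s p p' (g u : E) : 0 < p -> 0 < p' -> p^-1 + p'^-1 = 1 ->
  besov dim s p u -> besov dim (- s) p' g ->
  (asum (fun l => `|coef g l * coef u l|)%R < +oo)%E.
Proof.
move=> p0 p'0 pp' /(besovP _ _ p0) u_oo /(besovP _ _ p'0) g_oo.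
have := asum_young p'0 p0 _ g_oo u_oo; rewrite addrC => /(_ pp').
congr (_ < _)%E; apply: eq_esum => l _; congr (`|_|%:E).
rewrite /scaled mulrACA -powRD; last by rewrite pnatr_eq0 implybT.
rewrite -mulrDl (_ : besov_exponent _ _ + _ = 0) ?mul0r ?powRr0 ?mul1r//.
rewrite /besov_exponent !div1r (_ : p'^-1 = 1 - p^-1); first by field; rewrite gt_eqF.
by rewrite -pp' addrC addKr.
Qed.

(** As (q - 1) pG = p, every term on the left is a power of 2 times |c_l|^p, and the exponent
    condition compares that weight with the one of B^sS_pS. Passing from pS to p is the inclusion of
    l^pS in l^p. *)
Lemma source_mass q sG pG sS pS p t c : 0 < pG -> 0 < pS -> 0 < p -> pS <= p ->
  1 < q -> (q - 1) * pG = p ->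
  pG * (besov_exponent sG pG + t) + p * t <= p * besov_exponent sS pS ->
  (besov_mass sS pS c < +oo)%E ->
  (besov_mass sG pG (scaled t (fun l => powR_grad q (scaled t c l))) < +oo)%E.
Proof.
move=> pG0 pS0 p0 Sp q1 qp le_exp /(asum_powR_nested pS0 Sp).
apply: le_lt_trans; apply: le_asum => l.
rewrite powR_scaled norm_scaled norm_powR_grad// powRM ?powR_ge0// -!powRrM qp.
rewrite !powR_scaled !mulrA -!powRD; try by rewrite pnatr_eq0 implybT.
rewrite ler_wpM2r ?powR_ge0// ler_powR ?ler1n//.
rewrite [leLHS](_ : _ =
  (pG * (besov_exponent sG pG + t) + p * t) * (wav_scale l)%:R); last by ring.
by rewrite ler_wpM2r ?ler0n.
Qed.

Lemma tikhonovE (F : E -> L2 m) (vd : L2 m) (a s p : R) (u : E) : 0 < p ->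
  tikhonov dim F vd a s p u =
  ((L2_norm (F u - vd) ^+ 2)%:E + a%:E * besov_mass s p (coef u))%E.
Proof.
by move=> p0; rewrite -(besov_seq_norm_poweR s (coef u) p0).
Qed.

(** Comparison with the competitor [udag], whose residual is at most d. An infinite penalty of u
    would make its functional value infinite, while the value at [udag] is finite. *)
Lemma minimizer_mass (D : set E) (F : E -> L2 m) (v vd : L2 m) (udag u : E)
    (a d s p ry : R) : 0 < p -> 0 < a -> 0 <= d -> D udag ->
  F udag = v %[ae m] -> L2_norm (v - vd) <= d ->
  besov_mass s p (coef udag) = ry%:E ->
  minimizer_on D (tikhonov dim F vd a s p) u ->
  exists2 rx, besov_mass s p (coef u) = rx%:E &
    L2_norm (F u - vd) ^+ 2 + a * rx <= d ^+ 2 + a * ry.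
Proof.
move=> p0 a0 d0 Dudag Fv vvd ryE [_ /(_ _ Dudag)].
rewrite !tikhonovE// ryE => min.
have FvE : L2_norm (F udag - vd) = L2_norm (v - vd).
  apply: eq_L2_norm; apply: filterS Fv => z /= /[apply] h.
  by rewrite -[LHS]/(F udag z - vd z) h.
rewrite FvE in min.
have := besov_mass_ge0 s p (coef u); move: min.
case: (besov_mass s p (coef u)) => [rx|min _|//]; last first.
  by move: min; rewrite gt0_muley ?lte_fin// addey// leye_eq.
rewrite -!EFinM -!EFinD lee_fin => min _; exists rx => //.
apply: (le_trans min); rewrite lerD2r.
by rewrite ler_sqr ?nnegrE ?L2_norm_ge0.
Qed.

Lemma sobolev_norm_sub_le s p (u v : E) (k : R) :
  0 <= k ->
  (asum (fun l => `|scaled (besov_exponent s p) (coef u) l -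
                    scaled (besov_exponent s p) (coef v) l| `^ 2)%R <= k%:E)%E ->
  (sobolev_norm dim (besov_exponent s p) (u - v) <= (Num.sqrt k)%:E)%E.
Proof.
move=> k0; set S := asum _ => Sk.
rewrite /sobolev_norm /besov_norm besov_seq_normE.
have -> : besov_mass (besov_exponent s p) 2 (coef (u - v)) = S.
  (* At integrability 2 the dimension term 1/2 - 1/2 vanishes, so the weight of H^sigma is sigma
     itself. *)
  apply: eq_esum => l _; rewrite {1}/besov_exponent subrr mulr0 addr0.
  by rewrite /scaled coefB mulrBr.
rewrite -powR12_sqrt// -poweR_EFin; apply: gt0_ler_poweR => //.
- by rewrite in_itv/= leey andbT; apply: asum_ge0 => l; rewrite powR_ge0.
- by rewrite in_itv/= leey andbT lee_fin.
Qed.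

(** Through F^* w = xi, pairing the gradient with u - udag becomes <F u - v, w>, which the residuals
    control. B is fixed before a, d, [vd] and u, so the rate is uniform over all minimizers. *)
Lemma source_condition_rate (F : E -> L2 m) (v w : L2 m) (udag xi : E)
    (sD pD pD' s q c C : R) :
  1 < q <= 2 -> 0 < pD -> 0 < pD' -> pD^-1 + pD'^-1 = 1 -> 0 < c -> 0 < C ->
  besov dim sD pD udag -> F udag = v %[ae m] ->
  adjoint_value dim sD pD pD' F w xi ->
  coef xi =1 scaled (besov_exponent s q)
    (fun l => powR_grad q (scaled (besov_exponent s q) (coef udag) l)) ->
  exists2 B, 0 <= B & forall (a d : R) (vd : L2 m) (u : E),
    0 < d -> d <= 1 -> c * d <= a <= C * d -> L2_norm (v - vd) <= d ->
    minimizer_on (besov dim sD pD) (tikhonov dim F vd a s q) u ->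
    (sobolev_norm dim (besov_exponent s q) (u - udag) <= (Num.sqrt (B * d))%:E)%E.
Proof.
move=> q12 pD0 pD'0 pDD' c0 C0 udagD Fv [xiD Fw] xiE.
have /andP[q1 q2] := q12; have q0 : 0 < q by exact: lt_trans q1.
pose x (u : E) l := scaled (besov_exponent s q) (coef u) l; pose y := x udag.
have xi_mul u l : coef xi l * coef u l = powR_grad q (y l) * x u l.
  by rewrite xiE /x /scaled -mulrA mulrCA.
have xi_oo u : besov dim sD pD u ->
    (asum (fun l => `|powR_grad q (y l) * x u l|)%R < +oo)%E.
  move=> uD; apply: le_lt_trans (duality_summable pD0 pD'0 pDD' uD xiD).
  by apply: le_asum => l; rewrite xi_mul.
have inner_dsum u : besov dim sD pD u ->
    L2_inner (F u) w = dsum (fun l => powR_grad q (y l) * x u l).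
  by move=> uD; rewrite Fw// dualityE; congr dsum; apply/funext => l.
(* The penalty at udag is the pairing of xi and udag, hence finite. *)
have [ry ryE] : exists ry : R, besov_mass s q (coef udag) = ry%:E.
  exists (fine (besov_mass s q (coef udag))).
  rewrite fineK// ge0_fin_numE ?besov_mass_ge0//.
  apply: le_lt_trans (xi_oo _ udagD); apply: le_asum => l.
  by rewrite powR_grad_mul// (ger0_norm (powR_ge0 _ _)).
have ry0 : 0 <= ry by rewrite -lee_fin -ryE besov_mass_ge0.
(* By [le_mulr_bound] the penalty of u is at most c^-1 + ry; the summand 1 gives 1 <= M. K is the
   convexity constant of [bregman_bound]. *)
pose M := 1 + (c^-1 + ry); pose K := (q - 1) / 2 * M `^ (q - 2).
pose om := L2_norm w.
pose B := c^-1 + C * q ^+ 2 * om ^+ 2 / 4 + q * om.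
have c1 : 0 < c^-1 by rewrite invr_gt0.
have M1 : 1 <= M by rewrite lerDl addr_ge0// ltW.
have K0 : 0 < K.
  by rewrite !mulr_gt0 ?subr_gt0 ?invr_gt0 ?powR_gt0// (lt_le_trans _ M1).
have om0 : 0 <= om by exact: L2_norm_ge0.
have B0 : 0 <= B.
  rewrite !addr_ge0 ?(ltW c1)// ?mulr_ge0 ?(ltW q0) ?(ltW C0)//.
exists (K^-1 * B); first by rewrite mulr_ge0// invr_ge0 ltW.
move=> a d vd u d0 d1 /andP[ca aC] vvd umin.
have a0 : 0 < a by rewrite (lt_le_trans _ ca)// mulr_gt0.
have [rx rxE min] := minimizer_mass q0 a0 (ltW d0) udagD Fv vvd ryE umin.
have uD : besov dim sD pD u by case: umin.
pose z := L2_inner (F u) w - L2_inner v w.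
(* Inserting [vd] lets Cauchy-Schwarz bound z by the residual of u and the noise level. *)
have zE : z = L2_inner (F u - vd) w - L2_inner (v - vd) w.
  by rewrite !L2_innerBl /z opprB addrA subrK.
have zle : `|z| <= (L2_norm (F u - vd) + d) * om.
  rewrite zE mulrDl (le_trans (ler_normB _ _))// lerD ?L2_cauchy_schwarz//.
  by rewrite (le_trans (L2_cauchy_schwarz _ _))// ler_wpM2r.
have Bd := tikhonov_real_bound c0 a0 d0 om0 (L2_norm_ge0 _) q0 ca aC min zle (erefl _).
have rxM : rx <= M.
  by rewrite (le_trans (le_mulr_bound c0 d0 d1 ca min))// lerDr.
have ryM : ry <= M by rewrite /M addrA lerDr addr_ge0// ltW.
have := bregman_bound q12 M1 rxM ryM rxE ryE (xi_oo _ uD).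
rewrite -(inner_dsum _ uD) -(inner_dsum _ udagD) (eq_L2_inner w Fv) => Sle.
apply: sobolev_norm_sub_le.
  by rewrite !mulr_ge0 ?invr_ge0// ltW.
rewrite -mulrA EFinM -lee_pdivrMl ?invr_gt0// invrK.
by apply: (le_trans Sle); rewrite lee_fin.
Qed.

End besov_lemmas.

(** * Arithmetic of the exponents and the convergence rate *)

Lemma penalty_power (R : realType) (p pG q : R) : 0 < p -> p <= pG ->
  q = (p + pG) / pG -> 1 < q <= 2 /\ (q - 1) * pG = p.
Proof.
move=> p0 ppG ->; have pG0 := lt_le_trans p0 ppG.
split; last by field; rewrite gt_eqF.
by rewrite ltr_pdivlMr// ler_pdivrMr// mul1r ltrDr p0/= mulr_natl mulr2n lerD2r.
Qed.

(** The slack is p + pG times the distance from s to its bound without the eps term, and that term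
    is nonnegative because pS <= p. *)
Lemma source_exponent_le (R : realType) (dim : nat) (sG pG sS pS p eps q s : R) :
  0 < pG -> 0 < pS -> 0 < p -> pS <= p -> 0 <= eps -> q = (p + pG) / pG ->
  s <= (p * sS - pG * sG) / (p + pG) - dim%:R * (1 / (p + pG) * (p / pS - 1))
       - eps * (p / pS - 1) ->
  pG * (besov_exponent dim sG pG + besov_exponent dim s q) +
    p * besov_exponent dim s q <= p * besov_exponent dim sS pS.
Proof.
move=> pG0 pS0 p0 Sp eps0 -> sle; have ppG0 : 0 < p + pG by exact: addr_gt0.
rewrite -subr_ge0.
rewrite (_ : _ - _ = (p + pG) * ((p * sS - pG * sG) / (p + pG) -
  dim%:R * (1 / (p + pG) * (p / pS - 1)) - s)); last first.
  by rewrite /besov_exponent; field; rewrite !gt_eqF.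
rewrite mulr_ge0 ?(ltW ppG0)// subr_ge0 (le_trans sle)// gerBl mulr_ge0//.
by rewrite subr_ge0 ler_pdivlMr// mul1r.
Qed.

Theorem theorem4p1 (R : realType) (dim : nat)
    (mu : {measure set (euclidean R dim) -> \bar R})
    (hmu : is_lebesgue_measure mu)
    (Omega : set (euclidean R dim)) (mOmega : measurable Omega)
    (W : wavelet_basis (mrestr mu mOmega)) (E : distributions W)
    (sD pD pD' sG pG sS pS p eps pR sR sigma : R)
    (hpD : 1 < pD) (hpD' : pD^-1 + pD'^-1 = 1)
    (hpG : 0 < pG) (hpS : 0 < pS) (hSG : pS <= pG)
    (hp : 0 < p) (hSp : pS <= p) (hpDG : p <= Num.min pD pG)
    (heps : 0 < eps)
    (hpR : pR = (p + pG) / pG)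
    (hsR : sR <= (p * sS - pG * sG) / (p + pG)
                 - dim%:R * (1 / (p + pG) * (p / pS - 1))
                 - eps * (p / pS - 1))
    (hsigma : sigma = sR + dim%:R * (1 / 2 - 1 / pR))
    (hchar : forall sp : R * R,
       sp \in [:: (sD, pD); (- sD, pD'); (sG, pG); (sS, pS); (sR, pR); (sigma, 2)] ->
       characterized dim E sp.1 sp.2)
    (F : E -> L2 (mrestr mu mOmega))
    (Flin : linear_on_besov dim sD pD F)
    (Fcont : continuous_on_besov dim sD pD F)
    (hrg : adjoint_range dim sD pD pD' F = besov dim sG pG)
    (hGD : besov_embedding dim E sG pG (- sD) pD')
    (v : L2 (mrestr mu mOmega)) (udag : E)
    (hSD : besov_embedding dim E sS pS sD pD)
    (hudag : besov dim sS pS udag)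
    (hFu : F udag = v %[ae mrestr mu mOmega])
    (vd : R -> L2 (mrestr mu mOmega))
    (hvd : forall delta, 0 < delta -> L2_norm (v - vd delta) <= delta)
    (alpha : R -> R)
    (halpha0 : forall delta, 0 < delta -> 0 < alpha delta)
    (halpha : asymp_equiv alpha id)
    (ud : R -> E)
    (hud : forall delta, 0 < delta ->
       minimizer_on (besov dim sD pD)
         (tikhonov dim F (vd delta) (alpha delta) sR pR) (ud delta)) :
  bigO_right0 (fun delta => sobolev_norm dim sigma (ud delta - udag)) Num.sqrt.
Proof.
have /andP[ppD ppG] : (p <= pD) && (p <= pG) by rewrite -le_min.
have pD0 : 0 < pD by exact: lt_le_trans ppD.
have pD'0 : 0 < pD'.
  by rewrite -invr_gt0 -[pD'^-1](addKr pD^-1) hpD' addrC subr_gt0 invf_lt1.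
have [q12 qp] := penalty_power hp ppG hpR.
have /andP[q1 _] := q12.
have udagS := (besovP dim sS udag hpS).1 hudag.
have xi_mass := source_mass hpG hpS hp hSp q1 qp
  (source_exponent_le hpG hpS hp hSp (ltW heps) hpR hsR) udagS.
have charG : characterized dim E sG pG.
  by have := hchar (sG, pG); apply; rewrite !inE eqxx !orbT.
have [xi xiE] := charG _ ((besov_seq_norm_lty dim sG _ hpG).2 xi_mass).
(* The gradient sequence is now realized by xi in B^sG_pG, which is the range of F^*; this yields
   the source element w. *)
have : adjoint_range dim sD pD pD' F xi.
  by rewrite hrg; apply/besovP => //; rewrite (funext xiE).
move=> [w Fw].
have udagD : besov dim sD pD udag by exact: hSD.1.
have [c [C [c0 C0 cC]]] := halpha.
have [B B0 rate] := source_condition_rate q12 pD0 pD'0 hpD' c0 C0 udagD hFu Fw xiE.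
(* The rate sqrt (B d) factors as sqrt B times sqrt d, and d <= 1 holds near 0. *)
exists (Num.sqrt B); near=> d.
have d0 : 0 < d by near: d; exact: nbhs_right_gt.
have d1 : d <= 1 by near: d; exact: nbhs_right_le.
rewrite hsigma -sqrtrM//.
exact: rate d0 d1 (cC _ d0) (hvd _ d0) (hud _ d0).
Unshelve. all: by end_near. Qed.
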